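(* Let $\Omega\subset\mathbb R^d$ be open and convex with $\mathcal C^{2,\alpha}$ boundary for some $\alpha\in(0,1)$, let $\mu$ be a probability measure on $\Omega$ whose density is bounded below by $\lambda>0$ on $\Omega$, and let $f$ be $\kappa$-strongly convex on $\Omega$, $\kappa>0$. For every $n\ge1$ and every convex polyhedral function $$g(x)=\max_{1\le j\le N}\{\langle a_j,x\rangle+b_j\},\qquad a_j\in\mathbb R^d,\ b_j\in\mathbb R,\ N\le n,$$ one has $$\inf_{c\in\mathbb R}\|g-f-c\|_{L^1(\mu)}\ge\lambda\,c_d\,\kappa\,|\Omega|^{1+2/d}\,n^{-2/d},\qquad c_d=\frac{d\,\omega_d^{-2/d}}{4(d+2)(1+2^d)},$$ where $\omega_d$ is the volume of the Euclidean unit ball in $\mathbb R^d$.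
   Context: $|\cdot|$ is Lebesgue measure. A function $f$ is $\kappa$-strongly convex on $\Omega$ if $f-\frac\kappa2\|\cdot\|^2$ is convex on $\Omega$. *)

(* Defs.v *)
From HB Require Import structures.
From mathcomp Require Import all_boot all_order all_algebra.
From mathcomp Require Import all_classical all_reals all_analysis.
Import Order.TTheory GRing.Theory Num.Theory.
Import numFieldNormedType.Exports.
Set Implicit Arguments.
Unset Strict Implicit.
Unset Printing Implicit Defensive.
Local Open Scope classical_set_scope.
Local Open Scope ring_scope.

(* R^d is the type 'rV[R]_d of row vectors. The library norm `|x| on it is the
   sup norm, which induces the usual topology; the Euclidean norm is enorm. *)

Definition dot {R : realType} {d : nat} (x y : 'rV[R]_d) : R :=
  (x *m y^T) 0 0.

Definition enorm {R : realType} {d : nat} (x : 'rV[R]_d) : R :=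
  Num.sqrt (dot x x).

Section measurable_rV.
Context {R : realType} (d : nat).

(* The sigma-algebra of R^d is generated by the coordinates, exactly as the
   library does for d.-tuple; it coincides with the Borel sigma-algebra. *)
Definition coord_rV (i : 'I_d) (x : 'rV[R]_d) : measurableTypeR R := x 0 i.

Let rV_set0 : g_sigma_preimage coord_rV set0.
Proof. exact: sigma_algebra0. Qed.

Let rV_setC A : g_sigma_preimage coord_rV A -> g_sigma_preimage coord_rV (~` A).
Proof. exact: sigma_algebraC. Qed.

Let rV_bigcup (F : (set 'rV[R]_d)^nat) :
  (forall i, g_sigma_preimage coord_rV (F i)) ->
  g_sigma_preimage coord_rV (\bigcup_i (F i)).
Proof. exact: sigma_algebra_bigcup. Qed.

HB.instance Definition _ := @isMeasurable.Build default_measure_display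
  'rV[R]_d (g_sigma_preimage coord_rV) rV_set0 rV_setC rV_bigcup.

End measurable_rV.

Section measurable_rV_lemmas.
Context {R : realType}.

Lemma measurable_coord_rV (d : nat) (i : 'I_d) :
  measurable_fun [set: 'rV[R]_d] (@coord_rV R d i).
Proof.
move=> _ Y mY; rewrite setTI; apply: sub_sigma_algebra => /=.
rewrite -bigcup_seq/=; exists i => /=; first by rewrite mem_index_enum.
by exists Y => //; rewrite setTI.
Qed.

Lemma measurable_fun_rVP d0 (T : measurableType d0) (d : nat)
    (f : T -> 'rV[R]_d) :
  (forall i, measurable_fun [set: T] (@coord_rV R d i \o f)) ->
  measurable_fun [set: T] f.
Proof.
move=> mf _ A mA; rewrite setTI.
suff sub : g_sigma_preimage (fun i => @coord_rV R d i \o f) `<=` measurable.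
  by apply: sub; rewrite g_sigma_preimage_comp; exists A => //; rewrite setTI.
apply: smallest_sub; first exact: sigma_algebra_measurable.
rewrite -bigcup_seq; apply: bigcup_sub => i _ B [C mC <-].
exact: mf.
Qed.

Definition cons_rV (d : nat) (p : measurableTypeR R * 'rV[R]_d) : 'rV[R]_d.+1 :=
  row_mx (p.1 : R)%:M p.2.

Definition behead_rV (d : nat) (x : 'rV[R]_d.+1) : 'rV[R]_d :=
  rsubmx (x : 'rV[R]_(1 + d)).

Lemma coord_cons_rV0 (d : nat) (p : measurableTypeR R * 'rV[R]_d) :
  coord_rV ord0 (cons_rV p) = p.1.
Proof.
rewrite /coord_rV /cons_rV.
have -> : (ord0 : 'I_d.+1) = lshift d (ord0 : 'I_1) by exact: val_inj.
by rewrite [LHS](@row_mxEl _ 1 1 d) mxE.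
Qed.

Lemma coord_cons_rV (d : nat) (p : measurableTypeR R * 'rV[R]_d) (i : 'I_d) :
  coord_rV (lift ord0 i) (cons_rV p) = coord_rV i p.2.
Proof.
rewrite /coord_rV /cons_rV.
have -> : lift ord0 i = rshift 1 i by exact: val_inj.
exact: row_mxEr.
Qed.

Lemma measurable_cons_rV (d : nat) : measurable_fun setT (@cons_rV d).
Proof.
apply: measurable_fun_rVP => i.
have [j ->|->] := unliftP ord0 i.
  rewrite (_ : _ \o _ = @coord_rV R d j \o snd); last first.
    by apply/funext => p; rewrite /= coord_cons_rV.
  by apply: measurableT_comp; [exact: measurable_coord_rV|].
by rewrite (_ : _ \o _ = fst)//; apply/funext => p; rewrite /= coord_cons_rV0.
Qed.

Lemma measurable_behead_rV (d : nat) : measurable_fun setT (@behead_rV d).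
Proof.
apply: measurable_fun_rVP => i.
rewrite (_ : _ \o _ = coord_rV (lift ord0 i)); first exact: measurable_coord_rV.
apply/funext => x; rewrite /coord_rV /behead_rV /= mxE.
by congr (x _ _); exact: val_inj.
Qed.

Lemma behead_cons_rV (d : nat) (p : measurableTypeR R * 'rV[R]_d) :
  behead_rV (cons_rV p) = p.2.
Proof. exact: row_mxKr. Qed.

End measurable_rV_lemmas.

Section lebesgue_measure_rV.
Context {R : realType}.
Local Open Scope ereal_scope.

Section step.
Variables (d : nat) (m : {sigma_finite_measure set 'rV[R]_d -> \bar R}).

Definition lebesgue_rV_step : set 'rV[R]_d.+1 -> \bar R :=
  pushforward (@lebesgue_measure R \x m) (@cons_rV R d).

Let step0 : lebesgue_rV_step set0 = 0.
Proof. by rewrite /lebesgue_rV_step /pushforward preimage_set0 measure0. Qed.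

Let step_ge0 A : 0 <= lebesgue_rV_step A.
Proof. by apply: integral_ge0 => x _; exact: measure_ge0. Qed.

Let step_sigma_additive : semi_sigma_additive lebesgue_rV_step.
Proof.
move=> F mF tF mUF; rewrite /lebesgue_rV_step /pushforward preimage_bigcup.
apply: measure_semi_sigma_additive.
- by move=> n; rewrite -[X in measurable X]setTI; exact: measurable_cons_rV.
- apply/trivIsetP => /= i j _ _ ij; rewrite -preimage_setI.
  by move/trivIsetP : tF => /(_ _ _ _ _ ij) ->//; rewrite preimage_set0.
- by rewrite -preimage_bigcup -[X in measurable X]setTI;
    exact: measurable_cons_rV.
Qed.

HB.instance Definition _ := isMeasure.Build _ _ _
  lebesgue_rV_step step0 step_ge0 step_sigma_additive.

Lemma lebesgue_rV_stepX (A : set (measurableTypeR R)) (B : set 'rV[R]_d) :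
  measurable A -> measurable B ->
  lebesgue_rV_step (coord_rV ord0 @^-1` A `&` @behead_rV R d @^-1` B) =
  lebesgue_measure A * m B.
Proof.
move=> mA mB; rewrite /lebesgue_rV_step /pushforward.
rewrite -product_measure1E//; congr ((_ \x _) _).
by apply/seteqP; split => -[x y] /=; rewrite coord_cons_rV0 behead_cons_rV.
Qed.

Let step_sigma_finite : sigma_finite setT lebesgue_rV_step.
Proof.
have /sigma_finiteP[F [TF ndF Foo]] := sigma_finiteT (@lebesgue_measure R).
have /sigma_finiteP[G [TG ndG Goo]] := sigma_finiteT m.
exists (fun n => coord_rV ord0 @^-1` F n `&` @behead_rV R d @^-1` G n).
  apply/seteqP; split => // x _.
  have [i _ Fi] : (\bigcup_n F n) (coord_rV ord0 x) by rewrite -TF.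
  have [j _ Gj] : (\bigcup_n G n) (behead_rV x) by rewrite -TG.
  exists (maxn i j) => //; split => /=.
    by move: Fi; exact/subsetPset/ndF/leq_maxl.
  by move: Gj; exact/subsetPset/ndG/leq_maxr.
move=> k; have [mF Fk] := Foo k; have [mG Gk] := Goo k; split.
  apply: measurableI; rewrite -[X in measurable X]setTI.
    exact: measurable_coord_rV.
  exact: measurable_behead_rV.
by rewrite lebesgue_rV_stepX// lte_mul_pinfty// ge0_fin_numE.
Qed.

HB.instance Definition _ := Measure_isSigmaFinite.Build _ _ _
  lebesgue_rV_step step_sigma_finite.

End step.

Fixpoint lebesgue_rV_rec (d : nat) :
    {sigma_finite_measure set 'rV[R]_d -> \bar R} :=
  if d is d'.+1 then lebesgue_rV_step (lebesgue_rV_rec d')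
  else @dirac _ 'rV[R]_0 0%R R.

(* Lebesgue measure on R^d, as the d-fold product of the one-dimensional one;
   see lebesgue_rV_box. *)
Definition lebesgue_rV (d : nat) : set 'rV[R]_d -> \bar R := lebesgue_rV_rec d.

HB.instance Definition _ (d : nat) :=
  SigmaFiniteMeasure.copy (@lebesgue_rV d) (lebesgue_rV_rec d).

Lemma lebesgue_rV_box (d : nat) (A : 'I_d -> set (measurableTypeR R)) :
  (forall i, measurable (A i)) ->
  lebesgue_rV [set x : 'rV[R]_d | forall i, A i (x 0%R i)] =
  \prod_(i < d) lebesgue_measure (A i).
Proof.
rewrite /lebesgue_rV; elim: d A => [|d IH] A mA.
  rewrite big_ord0 /= diracE mem_set//=; by case.
rewrite big_ord_recl /= -IH// -lebesgue_rV_stepX//; last first.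
  rewrite (_ : mkset _ = \bigcap_(i in [set: 'I_d])
    (@coord_rV R d i @^-1` A (lift ord0 i))); last first.
    by apply/seteqP; split => x /= h i *; exact: h.
  apply: fin_bigcap_measurable => // i _; rewrite -[X in measurable X]setTI.
  exact: measurable_coord_rV.
congr (lebesgue_rV_step _ _).
have bE (x : 'rV[R]_d.+1) i : behead_rV x 0%R i = x 0%R (lift ord0 i).
  by rewrite /behead_rV mxE; congr (x _ _); exact: val_inj.
apply/seteqP; split => x /=.
  move=> h; split; first exact: h.
  by move=> i; rewrite bE; exact: h.
move=> [h0 h] i; have [j ->|->//] := unliftP ord0 i.
by rewrite -bE; exact: h.
Qed.

End lebesgue_measure_rV.

Definition unit_ball_volume (R : realType) (d : nat) : R :=
  fine (lebesgue_rV [set x : 'rV[R]_d | enorm x < 1]).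

Definition c_ (R : realType) (d : nat) : R :=
  d%:R * unit_ball_volume R d `^ (- (2 / d%:R)) /
  (4 * (d%:R + 2) * (1 + 2 ^+ d)).

Definition strongly_convex {R : realType} {d : nat} (kappa : R)
    (Omega : set 'rV[R]_d) (f : 'rV[R]_d -> R) : Prop :=
  convex_function Omega (fun x => f x - kappa / 2 * enorm x ^+ 2).

Definition locally_holder {R : realType} {n : nat} (alpha : R)
    (h : 'rV[R]_n -> R) : Prop :=
  forall x : 'rV[R]_n, exists C : R,
    \forall y & z \near x, `|h y - h z| <= C * enorm (y - z) `^ alpha.

Fixpoint class_Ckalpha {R : realType} {n : nat} (k : nat) (alpha : R)
    (h : 'rV[R]_n -> R) : Prop :=
  if k is k'.+1 then
    continuous h /\
    forall i : 'I_n, (forall x, derivable h x (delta_mx 0 i)) /\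
      class_Ckalpha k' alpha (fun x => 'D_(delta_mx 0 i) h x)
  else locally_holder alpha h.

(* Near each boundary point, Omega is the strict epigraph of a C^{k,alpha}
   function in the Cartesian coordinates given by an orthonormal basis: the rows
   of E span the base hyperplane, v is the vertical direction. Local Hoelder
   continuity is enough in class_Ckalpha because r can be decreased. *)
Definition Ckalpha_boundary {R : realType} {d : nat} (k : nat) (alpha : R)
    (Omega : set 'rV[R]_d) : Prop :=
  forall x0, (closure Omega `\` Omega°) x0 ->
  exists (E : 'M[R]_(d.-1, d)) (v : 'rV[R]_d)
         (gamma : 'rV[R]_d.-1 -> R) (r : R),
    [/\ [/\ E *m E^T = 1%:M, E *m v^T = 0 & dot v v = 1],
        class_Ckalpha k alpha gamma, 0 < r &
        forall x, enorm (x - x0) < r ->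
          (Omega x <-> gamma (x *m E^T) < dot v x)].

(* mu is carried by Omega and has density rho there w.r.t. Lebesgue measure. *)
Definition density_on {R : realType} {d : nat}
    (mu : probability 'rV[R]_d R) (Omega : set 'rV[R]_d)
    (rho : 'rV[R]_d -> R) : Prop :=
  [/\ measurable_fun Omega rho,
      {ae @lebesgue_rV R d, forall x, Omega x -> 0 <= rho x} &
      forall A, measurable A ->
        mu A = (\int[@lebesgue_rV R d]_(x in A `&` Omega) (rho x)%:E)%E].

(* A maximum of N.+1 >= 1 affine functions: the maximum over an empty family is
   not a real-valued function. *)
Definition max_affine {R : realType} {d N : nat}
    (a : 'I_N.+1 -> 'rV[R]_d) (b : 'I_N.+1 -> R) (x : 'rV[R]_d) : R :=
  \big[Num.max/dot (a ord0) x + b ord0]_(j < N.+1) (dot (a j) x + b j).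

(* The L^1(mu) norm of a function known on Omega, where mu is carried. *)
Definition L1norm {R : realType} {d : nat} (mu : probability 'rV[R]_d R)
    (Omega : set 'rV[R]_d) (h : 'rV[R]_d -> R) : \bar R :=
  Lnorm mu 1 ((EFin \o h) \_ Omega).

(* Main.v *)
(* Fix an affine piece l of g and its cell P, and put phi = f + c - l, which is
   kappa-strongly convex on P.  If z nearly minimises phi on P, then up to an
   arbitrarily small error
     phi(x) - phi((x + z)/2) >= kappa/4 |x - z|^2   for x in P.
   Integrating over P, and bounding the integral of |phi((x + z)/2)| by 2^d
   times that of |phi| because x |-> (x + z)/2 maps P into itself, gives
     (1 + 2^d) int_P |phi| >= kappa/4 int_P |x - z|^2.
   For every r the second moment is at least
   r^2 |P| - int (r^2 - |x - z|^2)_+ = r^2 |P| - 2 omega_d r^(d+2)/(d+2).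
   Taking the same r for all cells and summing, the choice
   r^d = |Omega|/(n omega_d) yields the constant c_d. *)
Require Import Defs.
From mathcomp Require Import all_boot all_order all_algebra.
From mathcomp Require Import all_classical all_reals all_analysis.
Import Order.TTheory GRing.Theory Num.Theory.
Import numFieldNormedType.Exports.
From mathcomp Require Import measurable_realfun ring lra.
Set Implicit Arguments.
Unset Strict Implicit.
Unset Printing Implicit Defensive.
Local Open Scope classical_set_scope.
Local Open Scope ring_scope.

(** * Affine changes of variables *)

(** The right-hand side is a measure in [A]. For [a < b] the preimage of []a, b]] has length
    [(b - a) / k], so this measure agrees with Lebesgue measure on half-open intervals, which
    determines it. *)
Lemma lebesgue_measure_affine (R : realType) (k z : R)
    (A : set (measurableTypeR R)) :
  0 < k -> measurable A ->
  lebesgue_measure A = (k%:E * lebesgue_measure [set x | A (k * x + z)%R])%E.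
Proof.
move=> k0 mA.
pose phi (x : measurableTypeR R) : measurableTypeR R := k * x + z.
have mphi : measurable_fun setT phi.
  by apply: measurable_funD => //; exact: measurable_funM.
pose nu : {measure set (measurableTypeR R) -> \bar R} :=
  mscale (NngNum (ltW k0)) (pushforward lebesgue_measure phi).
rewrite -[RHS]/(nu mphi A); apply: lebesgue_measure_unique => //.
move=> _ [[a b] _ <-] /=; rewrite /nu /= /mscale /= /pushforward.
rewrite (_ : _ @^-1` _ = `]((a - z) / k), ((b - z) / k)]%classic).
  rewrite !lebesgue_measure_itv /= !lte_fin ltr_pM2r ?invr_gt0// ltrD2r.
  case: ifPn => _; last by rewrite mule0.
  by rewrite -!EFinD -EFinM; congr EFin; field; rewrite gt_eqF.
apply/seteqP; split => x /=; rewrite !in_itv/= /phi;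
  by rewrite ler_pdivlMr// ltr_pdivrMr// ltrBlDr lerBrDr (mulrC x).
Qed.

Section affine_rV.
Context {R : realType} {d : nat}.

(** A pi-system on which [lebesgue_rV_box] gives the volume as a product; measures are compared on
    it. *)
Definition boxes : set (set 'rV[R]_d) :=
  [set [set x : 'rV[R]_d | forall i, A i (x 0 i)] |
    A in [set A : 'I_d -> set (measurableTypeR R) | forall i, measurable (A i)]].

Lemma measurable_box (A : 'I_d -> set (measurableTypeR R)) :
  (forall i, measurable (A i)) ->
  measurable [set x : 'rV[R]_d | forall i, A i (x 0 i)].
Proof.
move=> mA; rewrite (_ : mkset _ =
    \bigcap_(i in [set: 'I_d]) (@coord_rV R d i @^-1` A i)).
  apply: fin_bigcap_measurable => // i _; rewrite -[X in measurable X]setTI.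
  exact: measurable_coord_rV.
by apply/seteqP; split => x /= h i *; exact: h.
Qed.

Lemma measurable_boxesE : @measurable _ 'rV[R]_d = <<s boxes >>.
Proof.
apply/seteqP; split.
  apply: smallest_sub; first exact: smallest_sigma_algebra.
  rewrite -bigcup_seq; apply: bigcup_sub => i _ _ [C mC <-].
  apply: sub_sigma_algebra.
  (* A condition on the single coordinate [i] is a box whose other sides are [setT]. *)
  exists (fun j => if j == i then C else setT) => /= [j|].
    by case: ifP.
  apply/seteqP; split => x /=; first by move=> /(_ i); rewrite eqxx.
  by move=> [_ Cx] j; case: eqP => // ->.
apply: smallest_sub; first exact: sigma_algebra_measurable.
by move=> _ [A mA <-]; exact: measurable_box.
Qed.

Lemma boxes_setI : setI_closed boxes.
Proof.
move=> _ _ [A mA <-] [B mB <-]; exists (fun i => A i `&` B i) => /= [i|].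
  exact: measurableI.
apply/seteqP; split => x /=; first by move=> h; split=> i; have [] := h i.
by move=> [h1 h2] i; split.
Qed.

Lemma measurable_fun_affine (k : R) (z : 'rV[R]_d) :
  measurable_fun setT (fun x : 'rV[R]_d => k *: x + z).
Proof.
apply: (@measurable_fun_rVP R _ 'rV[R]_d d) => i.
rewrite (_ : _ \o _ = fun x => k * coord_rV i x + z 0 i); last first.
  by apply/funext => x /=; rewrite /coord_rV !mxE.
apply: measurable_funD => //; apply: measurable_funM => //.
exact: measurable_coord_rV.
Qed.

(** Both sides are measures in [A]. On a box each of the [d] sides contributes one factor [k], and
    cubes of finite volume exhaust the space, so the two measures coincide. *)
Lemma lebesgue_rV_affine (k : R) (z : 'rV[R]_d) (A : set 'rV[R]_d) :
  0 < k -> measurable A ->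
  lebesgue_rV A =
  ((k ^+ d)%:E * lebesgue_rV [set x | A (k *: x + z)%R])%E.
Proof.
move=> k0 mA; pose phi (x : 'rV[R]_d) := k *: x + z.
have kd0 : 0 <= k ^+ d by rewrite exprn_ge0// ltW.
pose nu : {measure set 'rV[R]_d -> \bar R} :=
  mscale (NngNum kd0) (pushforward (@lebesgue_rV R d) phi).

have mphi : measurable_fun setT phi by exact: measurable_fun_affine.
rewrite -[RHS]/(nu mphi A).
pose g (m : nat) := [set x : 'rV[R]_d | forall i : 'I_d,
   `[- m%:R, m%:R]%classic (x 0 i)].
apply: (@measure_unique _ _ _ boxes g) => //; first exact: measurable_boxesE.
- exact: boxes_setI.
- by move=> m; exists (fun _ => `[- m%:R, m%:R]%classic).
- apply/seteqP; split => // x _.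
  have [m xm] : exists m : nat, forall i : 'I_d, `|x 0 i| <= m%:R.
    exists (Num.truncn (\sum_i `|x 0 i|)).+1 => i.
    apply: le_trans (ltW (truncnS_gt _)).
    by rewrite (bigD1 i)//= lerDl sumr_ge0.
  by exists m => // i /=; rewrite in_itv/= -ler_norml.
- move=> _ [B mB <-]; rewrite [LHS](lebesgue_rV_box mB) /nu /= /mscale /= /pushforward.
  rewrite (_ : _ @^-1` _ = [set x : 'rV[R]_d | forall i,
      [set t | B i (k * t + z 0 i)] (x 0 i)]); last first.
    by apply/seteqP; split => x /= h i; have := h i; rewrite /phi !mxE.
  rewrite (@lebesgue_rV_box _ _ (fun i => [set t | B i (k * t + z 0 i)])); last first.
    move=> i; rewrite -[X in measurable X]setTI.
    have : measurable_fun setT (fun t : measurableTypeR R => k * t + z 0 i).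
      by apply: measurable_funD => //; exact: measurable_funM.
    by move=> /(_ measurableT _ (mB i)).
  rewrite (eq_bigr _ (fun i _ => lebesgue_measure_affine (z 0 i) k0 (mB i))).
  rewrite big_split /=; congr (_ * _)%E.
  by rewrite prodEFin prodr_const card_ord.
- move=> m; rewrite [ltLHS](@lebesgue_rV_box _ _ (fun=> `[- m%:R, m%:R]%classic))//.
  rewrite (eq_bigr (fun _ => ((m%:R - - m%:R)%:E : \bar R))).
    by rewrite prodEFin ltry.
  move=> i _; rewrite lebesgue_measure_itv /= lte_fin.
  case: ifPn => [_|]; first by rewrite EFinB.
  rewrite -leNgt => h; congr EFin; have := ler0n R m; lra.
Qed.

End affine_rV.

(** * Open sets and convexity *)

Section open_rV.
Context {R : realType} {d : nat}.
Implicit Types (x y z v : 'rV[R]_d) (A : set 'rV[R]_d).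

Lemma rV_ball x (e : R) y :
  0 < e -> (forall i, `|x 0 i - y 0 i| < e) -> ball x e y.
Proof. by move=> e0 h; split => // i j; rewrite (ord1 i); exact: h. Qed.

Lemma open_rV_exists A x : open A -> A x ->
  exists2 e : R, 0 < e & forall y, (forall i, `|x 0 i - y 0 i| < e) -> A y.
Proof.
rewrite openE => oA /oA /nbhs_ballP[e e0 eA].
by exists e => // y h; apply: eA; exact: rV_ball.
Qed.

(** The sigma-algebra is generated by the coordinates; an open set is the countable union of the
    boxes with rational centre and half-width that it contains. *)
Lemma open_measurable_rV A : open A -> measurable A.
Proof.
move=> oA.
pose box (p : 'rV[rat]_d * rat) := [set y : 'rV[R]_d | forall i,
  `](ratr (p.1 0 i) - ratr p.2), (ratr (p.1 0 i) + ratr p.2)[%classic (y 0 i)].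
(* [F p] is [box p] if this box lies in [A] and is empty otherwise, so the union can run over all
   [p]. *)
pose F p := [set y | box p y /\ box p `<=` A].
rewrite (_ : A = \bigcup_p F p).
  apply: countable_bigcupT_measurable => [|p]; first exact: countableP.
  have [h|h] := pselect (box p `<=` A).
    rewrite (_ : F p = box p); last first.
      by apply/seteqP; split => y //= [].
    exact: (@measurable_box _ _ (fun i =>
      `](ratr (p.1 0 i) - ratr p.2), (ratr (p.1 0 i) + ratr p.2)[%classic)).
  by rewrite (_ : F p = set0)//; apply/seteqP; split => y //= [].
apply/seteqP; split => [x Ax|x [p _ [] h]]; last exact.
have [e e0 eA] := open_rV_exists oA Ax.
have [q /[!in_itv]/= /andP[q0 qe]] : exists q : rat, ratr q \in `]0, e / 2[.
  by apply: rat_in_itvoo; lra.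
have /choice[c cP] : forall i, exists r : rat, ratr r \in `](x 0 i - ratr q), (x 0 i + ratr q)[.
  by move=> i; apply: rat_in_itvoo; lra.
exists (\row_i c i, q) => //; split => [i /=|y yb].
  by have := cP i; rewrite mxE !in_itv/= => ?; lra.
apply: eA => i; have /= := yb i; have := cP i.
by rewrite mxE !in_itv/= ltr_norml => ? ?; lra.
Qed.

Definition convex_comb A := forall x y (t : R),
  A x -> A y -> 0 <= t <= 1 -> A (t *: x + (1 - t) *: y).

(** The average of [n + 2] points combines the average of the first [n + 1], with weight
    [(n + 1) / (n + 2)], and the last point. *)
Lemma convex_comb_avg A : convex_comb A ->
  forall n (z : 'I_n -> 'rV[R]_d), (0 < n)%N ->
  (forall i, A (z i)) -> A (n%:R^-1 *: \sum_i z i).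
Proof.
move=> cA [//|n] z _; elim: n z => [|n IH] z Az.
  by rewrite big_ord1 invr1 scale1r.
rewrite big_ord_recr /= scalerDr.
have := cA _ _ (n.+1%:R / n.+2%:R) (IH _ (fun i => Az (widen_ord (leqnSn _) i))) (Az ord_max).
rewrite scalerA mulrAC divff ?mul1r ?pnatr_eq0//.
rewrite (_ : 1 - n.+1%:R / n.+2%:R = n.+2%:R^-1); last first.
  have n2 : n.+2%:R != 0 :> R by rewrite pnatr_eq0.
  by rewrite -[X in X - _](divff n2) -mulrBl -natrB// subSnn mul1r.
apply; rewrite divr_ge0//= ler_pdivrMr// mul1r ler_nat//.
Qed.

(* The averages of [d] small moves along the axes fill a neighbourhood. *)
Lemma convex_algebraic_open A : convex_comb A ->
  (forall x v, A x -> exists2 e : R, 0 < e & A (x + e *: v)) -> open A.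
Proof.
move=> cA aA; rewrite openE => x Ax.
have seg v (e s : R) : 0 < e -> A (x + e *: v) -> 0 <= s <= e ->
    A (x + s *: v).
  move=> e0 Ae /andP[s0 se].
  have := cA _ _ (s / e) Ae Ax.
  rewrite scalerDr scalerA divfK ?gt_eqF// addrAC -scalerDl subrKC scale1r.
  by apply; rewrite divr_ge0 ?(ltW e0)//= ler_pdivrMr// mul1r.
have /choice[e eP] : forall i, exists e : R, 0 < e /\
    forall s, `|s| <= e -> A (x + s *: delta_mx 0 i).
  move=> i; have [e1 e10 A1] := aA x (delta_mx 0 i) Ax.
  have [e2 e20 A2] := aA x (- delta_mx 0 i) Ax.
  exists (Num.min e1 e2); split; first by rewrite lt_min e10.
  move=> s; rewrite le_min => /andP[s1 s2]; have [s0|s0] := leP 0 s.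
    by apply: (seg _ _ _ e10 A1); rewrite -(ger0_norm s0) s1 normr_ge0.
  rewrite -[s]opprK scaleNr -scalerN; apply: (seg _ _ _ e20 A2).
  by rewrite -(ltr0_norm s0) s2 normr_ge0.
have [d0|d0] := posnP d.
  apply/nbhs_ballP; exists 1 => //= y _; rewrite (_ : y = x)//.
  by apply/rowP => -[m md]; exfalso; move: md; rewrite d0.
(* [S^-1] is a positive number that is at most every [e i]. *)
pose S : R := \sum_i (e i)^-1.
have Se i : S^-1 <= e i.
  have ei0 : 0 < (e i)^-1 by rewrite invr_gt0; case: (eP i).
  rewrite -[leRHS]invrK lef_pV2 ?posrE//; last first.
    by rewrite /S (bigD1 i)//= ltr_wpDr// sumr_ge0// => j _; rewrite invr_ge0 ltW//; case: (eP j).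
  by rewrite /S (bigD1 i)//= lerDl sumr_ge0// => j _; rewrite invr_ge0 ltW//; case: (eP j).
have S0 : 0 < S.
  rewrite /S (bigD1 (Ordinal d0))//= ltr_wpDr ?invr_gt0; try by case: (eP (Ordinal d0)).
  by rewrite sumr_ge0// => j _; rewrite invr_ge0 ltW//; case: (eP j).
have dR : 0 < d%:R :> R by rewrite ltr0n.
apply/nbhs_ballP; exists (S^-1 / d%:R) => [|y [_ xy]] /=.
  by rewrite divr_gt0 ?invr_gt0.
(* Each [z i] moves [d] times the wanted displacement along axis [i]; averaging over the [d] axes
   gives [y]. *)
pose z i := x + (d%:R * (y 0 i - x 0 i)) *: delta_mx 0 i.
have Az i : A (z i).
  apply: (eP i).2; apply: le_trans (Se i).
  rewrite normrM gtr0_norm// mulrC -ler_pdivlMr// distrC ltW//.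
  exact: xy.
rewrite (_ : y = d%:R^-1 *: \sum_i z i).
  exact: (convex_comb_avg cA).
rewrite /z big_split /= sumr_const card_ord scalerDr -[x *+ d]scaler_nat scalerA.
rewrite mulVf ?scale1r ?gt_eqF//.
apply/rowP => i; rewrite !mxE summxE (bigD1 i)//= !mxE !eqxx mulr1.
rewrite big1 => [|j ji]; last by rewrite !mxE eqxx /= eq_sym (negbTE ji) mulr0.
by rewrite addr0 mulKf ?gt_eqF// subrKC.
Qed.

End open_rV.

(** * The Euclidean inner product *)

Section dot_theory.
Context {R : realType} {d : nat}.
Implicit Types (a x y z : 'rV[R]_d).

Lemma dotE x y : dot x y = \sum_i x 0 i * y 0 i.
Proof. by rewrite /dot mxE; apply: eq_bigr => i _; rewrite mxE. Qed.

Lemma dot_ge0 x : 0 <= dot x x.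
Proof. by rewrite dotE sumr_ge0// => i _; rewrite -expr2 sqr_ge0. Qed.

Lemma enorm_sqr x : enorm x ^+ 2 = dot x x.
Proof. by rewrite sqr_sqrtr ?dot_ge0. Qed.

Lemma enorm_lt x (s : R) : 0 <= s -> (enorm x < s) = (dot x x < s ^+ 2).
Proof. by move=> s0; rewrite -enorm_sqr ltr_sqr ?nnegrE ?sqrtr_ge0. Qed.

Lemma dotZ (s : R) x : dot (s *: x) (s *: x) = s ^+ 2 * dot x x.
Proof.
by rewrite !dotE mulr_sumr; apply: eq_bigr => i _; rewrite !mxE; ring.
Qed.

Lemma dot_combr a x y (s t : R) : dot a (s *: x + t *: y) = s * dot a x + t * dot a y.
Proof.
rewrite !dotE !mulr_sumr -big_split; apply: eq_bigr => i _.
by rewrite !mxE /=; ring.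
Qed.

(** The last term is the exact convexity defect of the squared norm, the source of the quadratic
    gain in [strongly_convexP]. *)
Lemma dot_conv x y (t : R) :
  dot (t *: x + (1 - t) *: y) (t *: x + (1 - t) *: y) =
  t * dot x x + (1 - t) * dot y y - t * (1 - t) * dot (x - y) (x - y).
Proof.
rewrite !dotE !mulr_sumr -big_split/= -sumrB; apply: eq_bigr => i _.
by rewrite !mxE /=; ring.
Qed.

Lemma measurable_fun_dot a : measurable_fun setT (dot a).
Proof.
rewrite (_ : dot a = fun x => \sum_i a 0 i * coord_rV i x); last first.
  by apply/funext => x; rewrite dotE.
apply: measurable_sum => i; apply: measurable_funM => //.
exact: measurable_coord_rV.
Qed.

Lemma measurable_fun_sqdist z :
  measurable_fun setT (fun x : 'rV[R]_d => dot (x - z) (x - z)).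
Proof.
rewrite (_ : (fun x => _) = fun x => \sum_i (coord_rV i x - z 0 i) ^+ 2).
  apply: measurable_sum => i; apply: measurable_funX.
  by apply: measurable_funB => //; exact: measurable_coord_rV.
apply/funext => x; rewrite dotE; apply: eq_bigr => i _.
by rewrite /coord_rV !mxE expr2.
Qed.

End dot_theory.

(** * Strong convexity, and measurability of convex functions *)

Section strong_convexity.
Context {R : realType} {d : nat}.
Implicit Types (x y z v : 'rV[R]_d) (Omega : set 'rV[R]_d).

Lemma convex_set_comb Omega : convex_set Omega -> convex_comb Omega.
Proof.
move=> cO x y t /mem_set Ox /mem_set Oy /andP[t0 t1].
exact: set_mem (cO _ _ (Itv01 t0 t1) Ox Oy).
Qed.

Lemma convex_functionP Omega (f : 'rV[R]_d -> R) x y (t : R) :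
  convex_function Omega f -> Omega x -> Omega y -> 0 <= t <= 1 ->
  f (t *: x + (1 - t) *: y) <= t * f x + (1 - t) * f y.
Proof.
move=> cf /mem_set Ox /mem_set Oy /andP[t0 t1].
exact: (cf (Itv01 t0 t1) _ _ Ox Oy).
Qed.

Lemma strongly_convexP (k : R) Omega (f : 'rV[R]_d -> R) x y (t : R) :
  strongly_convex k Omega f -> Omega x -> Omega y -> 0 <= t <= 1 ->
  f (t *: x + (1 - t) *: y) <=
  t * f x + (1 - t) * f y - k / 2 * (t * (1 - t)) * dot (x - y) (x - y).
Proof.
move=> cf Ox Oy t01; have := convex_functionP cf Ox Oy t01.
rewrite !enorm_sqr dot_conv; set D := dot (x - y) _.
set a := dot x x; set b := dot y y; lra.
Qed.

(** The strict sublevel sets are convex and contain a short segment from each of their points in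
    every direction, hence are open by [convex_algebraic_open]. *)
Lemma convex_function_measurable Omega (f : 'rV[R]_d -> R) :
  open Omega -> convex_set Omega -> convex_function Omega f ->
  measurable_fun Omega f.
Proof.
move=> oO cO cf.
apply: (measurability (@RGenInftyO.G R)); first exact: RGenInftyO.measurableE.
move=> _ [_ [c ->] <-]; apply: open_measurable_rV.
apply: convex_algebraic_open => [x y t [Ox fx] [Oy fy] t01|x v [Ox fx]].
  split; first exact: convex_set_comb.
  move: fx fy; rewrite /= !in_itv/= => fx fy.
  apply: le_lt_trans (convex_functionP cf Ox Oy t01) _.
  (* For [t < 1] the strict bound at [y] has positive weight; at [t = 1] the point is [x]. *)
  have [->|t1] := eqVneq t 1; first by rewrite subrr mul0r mul1r addr0.
  move: t01 => /andP[t0 t1']; have tt : 0 < 1 - t by rewrite subr_gt0 lt_neqAle t1.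
  have : t * f x <= t * c by rewrite ler_wpM2l// ltW.
  have : (1 - t) * f y < (1 - t) * c by rewrite ltr_pM2l.
  lra.
have [e e0 Oe] : exists2 e : R, 0 < e & Omega (x + e *: v).
  have [e e0 eO] := open_rV_exists oO Ox.
  exists (e / (1 + \sum_i `|v 0 i|)).
    by rewrite divr_gt0// ltr_pwDl// sumr_ge0.
  apply: eO => i; rewrite !mxE opprD addNKr.
  have S0 : 0 < 1 + \sum_i `|v 0 i| by rewrite ltr_pwDl// sumr_ge0.
  rewrite normrN normrM gtr0_norm ?divr_gt0// mulrAC ltr_pdivrMr//.
  by rewrite ltr_pM2l// (bigD1 i)//= addrCA ltrDl ltr_pwDl// sumr_ge0.
move: fx; rewrite /= in_itv/= => fx.
(* Convexity raises [f] by at most [s] times its increment, which this [s] keeps below [c - f x];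
   the added 1 keeps the denominator positive. *)
pose s := Num.min 1 ((c - f x) / (1 + `|f (x + e *: v) - f x|)).
have B0 : 0 < 1 + `|f (x + e *: v) - f x| by rewrite ltr_pwDl.
have s0 : 0 < s by rewrite /s lt_min ltr01 divr_gt0// subr_gt0.
have s01 : 0 <= s <= 1 by rewrite ltW//= /s ge_min lexx.
have sE : x + (s * e) *: v = s *: (x + e *: v) + (1 - s) *: x.
  by rewrite scalerDr scalerA addrAC -scalerDl subrKC scale1r.
exists (s * e); first exact: mulr_gt0.
split; rewrite sE; first exact: convex_set_comb.
rewrite /= in_itv/=; apply: le_lt_trans (convex_functionP cf Oe Ox s01) _.
have : s * (1 + `|f (x + e *: v) - f x|) <= c - f x.
  by rewrite -ler_pdivlMr// /s ge_min lexx orbT.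
have : s * (f (x + e *: v) - f x) <= s * `|f (x + e *: v) - f x|.
  by rewrite ler_wpM2l ?ler_norm// ltW.
lra.
Qed.

Lemma strongly_convex_measurable (k : R) Omega (f : 'rV[R]_d -> R) :
  open Omega -> convex_set Omega -> strongly_convex k Omega f ->
  measurable_fun Omega f.
Proof.
move=> oO cO cf.
rewrite (_ : f = (fun x => f x - k / 2 * enorm x ^+ 2) \+
    (fun x => k / 2 * dot (x - 0) (x - 0))); last first.
  by apply/funext => x /=; rewrite subr0 enorm_sqr subrK.
apply: measurable_funD; first exact: convex_function_measurable.
apply: measurable_funTS; apply: measurable_funM => //.
exact: measurable_fun_sqdist.
Qed.

End strong_convexity.

(** * The radial tail *)

Lemma integral_itv_exprn (R : realType) (a b c : R) (n : nat) : a <= b ->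
  (\int[lebesgue_measure]_(x in `]a, b]) (c * x ^+ n)%:E =
   (c / n.+1%:R * (b ^+ n.+1 - a ^+ n.+1))%:E)%E.
Proof.
move=> ab.
have mX : measurable_fun `]a, b] (fun x : measurableTypeR R => (c * x ^+ n)%:E).
  by apply/measurable_EFinP; apply: measurable_funM.
rewrite integral_itv_obnd_cbnd//.
move: ab; rewrite le_eqVlt => /orP[/eqP <-|ab].
  by rewrite set_itv1 integral_set1// subrr mulr0.
pose F (x : R) : R := (c / n.+1%:R) * x ^+ n.+1.
have cX m : continuous (fun x : R => x ^+ m) by exact: exprn_continuous.
have dF (x : R) : is_derive x 1 F (c * x ^+ n).
  have h : is_derive x 1 (id ^+ n.+1) ((n.+1%:R * x ^+ n.+1.-1) *: (1 : R)).
    exact: is_deriveX.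
  have FE : F = (c / n.+1%:R) \*: ((id : R -> R) ^+ n.+1).
    apply/funext => y; rewrite /F /=; congr (_ * _).
    by elim: (n.+1) => // m IH; rewrite !exprS IH.
  rewrite FE; apply: is_derive_eq.
  rewrite -[LHS]/(c / n.+1%:R * ((n.+1%:R * x ^+ n) * 1)).
  by rewrite mulr1 mulrA divfK ?pnatr_eq0.
rewrite (@continuous_FTC2 _ _ F)//.
- by rewrite -EFinB /F -mulrBr.
- apply: continuous_subspaceT => x; apply: cvgM; first exact: cvg_cst.
  exact: cX.
- split.
  + by move=> x _; exact: ex_derive.
  + by apply/cvg_at_right_filter; apply: cvgM; [exact: cvg_cst|exact: cX].
  + by apply/cvg_at_left_filter; apply: cvgM; [exact: cvg_cst|exact: cX].
- by move=> x _; rewrite derive1E; exact: derive_val.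
Qed.

Section radial.
Context {R : realType} {d : nat}.
Implicit Types (x y z : 'rV[R]_d).

Lemma measurable_sqball z (t : R) :
  measurable [set x : 'rV[R]_d | dot (x - z) (x - z) < t].
Proof.
have /(_ measurableT [set true]) := measurable_fun_ltr (@measurable_fun_sqdist R d z)
  (@measurable_cst _ _ _ _ setT t).
rewrite setTI; apply=> //.
Qed.

(** The scaling by [s] followed by the translation by [z] carries the unit ball onto this ball. *)
Lemma lebesgue_rV_sqball z (s : R) : 0 < s ->
  lebesgue_rV [set x : 'rV[R]_d | dot (x - z) (x - z) < s ^+ 2] =
  ((s ^+ d)%:E * lebesgue_rV [set x : 'rV[R]_d | (enorm x < 1)%R])%E.
Proof.
move=> s0; rewrite (lebesgue_rV_affine z s0); last exact: measurable_sqball.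
congr (_ * lebesgue_rV _)%E; apply/seteqP; split => x /=;
  by rewrite addrK dotZ enorm_lt// expr1n gtr_pMr// exprn_gt0.
Qed.

(* Layer cake: [r^2 - |x - z|^2] is the integral of [2 s] over the radii
   [s <= r] of the balls around [z] that contain [x]. *)
Lemma integral_radial_tail z (r w : R) : 0 <= r ->
  lebesgue_rV [set x : 'rV[R]_d | enorm x < 1] = w%:E ->
  (\int[@lebesgue_rV R d]_x
     (Num.max 0 (r ^+ 2 - dot (x - z) (x - z)))%:E <=
   (2 * w * r ^+ (d + 2) / (d%:R + 2))%:E)%E.
Proof.
move=> r0 hw.
pose D x := dot (x - z) (x - z).
(* Pairs of a radius [s] in []0, r]] and a point of the open ball of radius [s] around [z]. *)
pose A := [set p : measurableTypeR R * 'rV[R]_d | `]0, r]%classic p.1 /\ D p.2 < p.1 ^+ 2].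
have mA : measurable A.
  rewrite (_ : A = (`]0, r]%classic `*` setT) `&` [set p | D p.2 < p.1 ^+ 2]).
    apply: measurableI; first exact: measurableX.
    have /(_ measurableT [set true]) := measurable_fun_ltr
      (measurableT_comp (@measurable_fun_sqdist R d z) (@measurable_snd _ _ (measurableTypeR R) _))
      (measurable_funX 2 (@measurable_fst _ _ (measurableTypeR R) 'rV[R]_d)).
    by rewrite setTI; exact.
  by apply/seteqP; split => p /= [h1 h2]; split=> //; case: h1.
pose F (p : measurableTypeR R * 'rV[R]_d) : \bar R := (2 * p.1 * \1_A p)%:E.
have F0 p : (0 <= F p)%E.
  rewrite lee_fin indicE; have [|] := boolP (p \in A); last by rewrite mulr0.
  by rewrite inE => -[/=]; rewrite in_itv/= => /andP[p0 _] _; rewrite mulr1 mulr_ge0// ltW.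
have mF : measurable_fun setT F.
  apply/measurable_EFinP; apply: measurable_funM => //.
    by apply: measurable_funM => //; exact: measurable_fst.
apply: (@le_trans _ _ (\int[@lebesgue_rV R d]_x \int[@lebesgue_measure R]_s F (s, x))%E).
  apply: ge0_le_integral => //.
  - by move=> x _; rewrite lee_fin le_max lexx.
  - apply/measurable_EFinP; apply: measurable_maxr => //.
    by apply: measurable_funB => //; exact: measurable_fun_sqdist.
  - exact: (@measurable_fun_fubini_tonelli_G _ _ _ _ _ (@lebesgue_measure R)).
  move=> x _; have [Dr|Dr] := leP (r ^+ 2) (D x).
    by rewrite max_l ?subr_le0//; exact: integral_ge0.
  rewrite max_r ?subr_ge0 ?(ltW Dr)//.
  have D0 : 0 <= D x by exact: dot_ge0.
  have sr : Num.sqrt (D x) <= r.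
    by rewrite -(ger0_norm r0) -sqrtr_sqr ler_wsqrtr// ltW.
  (* The integral of [2 s] from [|x - z|] to [r] is [r^2 - |x - z|^2]. *)
  have := integral_itv_exprn 2 1 sr.
  rewrite divff ?pnatr_eq0// mul1r sqr_sqrtr// => <-.
  rewrite integral_mkcond; apply: ge0_le_integral => //.
  - move=> s _; rewrite patchE; case: ifPn => // /[!inE] /=.
    rewrite in_itv/= => /andP[s0 _]; rewrite lee_fin mulr_ge0// expr1.
    by apply: le_trans (ltW s0); exact: sqrtr_ge0.
  - apply: (iffLR (measurable_restrictT _ _)) => //.
    by apply/measurable_EFinP; apply: measurable_funM.
  - exact: measurableT_comp mF (pair2_measurable x).
  move=> s _; rewrite patchE; case: ifPn => // /[!inE] /=; rewrite in_itv/= => /andP[s1 s2].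
  rewrite lee_fin indicE mem_set ?mulr1 ?expr1//.
  have s0 : 0 <= s by apply: le_trans (ltW s1); exact: sqrtr_ge0.
  split => /=; first by rewrite in_itv/= s2 andbT; apply: le_lt_trans s1; exact: sqrtr_ge0.
  by rewrite /= -(sqr_sqrtr D0) ltr_sqr ?nnegrE ?sqrtr_ge0.
(* After the exchange, the inner integral is [2 s] times the volume [w s^d] of the ball of radius
   [s]. *)
rewrite -(fubini_tonelli F)//.
apply: (@le_trans _ _ (\int[@lebesgue_measure R]_(s in `]0%R, r]) (2 * w * s ^+ d.+1)%:E)%E).
  rewrite [leRHS]integral_mkcond; apply: ge0_le_integral => //.
  - by move=> s _; exact: integral_ge0.
  - exact: (@measurable_fun_fubini_tonelli_F _ _ _ _ _ (@lebesgue_rV R d)).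
  - apply: (iffLR (measurable_restrictT _ _)) => //.
    by apply/measurable_EFinP; apply: measurable_funM.
  move=> s _; rewrite patchE; case: ifPn => [|hs]; last first.
    rewrite integral0_eq// => x _; rewrite /F indicE memNset ?mulr0//.
    by move=> [/= h _]; move/negP : hs; apply; rewrite inE.
  rewrite inE => hs; move: (hs); rewrite /= in_itv/= => /andP[s0 sr].
  rewrite (eq_integral (fun x => ((2 * s)%:E * (\1_[set x | D x < s ^+ 2] x)%:E)%E)); last first.
    move=> x _; rewrite /F -EFinM !indicE; congr (_ * _%:R)%:E.
    by congr nat_of_bool; apply/idP/idP; rewrite !inE => // -[].
  rewrite ge0_integralZl_EFin//; last 2 first.
  - by apply/measurable_EFinP; apply: measurable_indic; exact: measurable_sqball.
  - by rewrite mulr_ge0// ltW.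
  rewrite integral_indic//; last exact: measurable_sqball.
  rewrite setIT [X in (_ * X)%E](lebesgue_rV_sqball z s0) hw -!EFinM lee_fin exprS.
  by rewrite le_eqVlt; apply/orP; left; apply/eqP; ring.
rewrite integral_itv_exprn// lee_fin expr0n subr0 addn2 -natr1 -natr1.
rewrite le_eqVlt; apply/orP; left; apply/eqP.
by field; rewrite -natrD pnatr_eq0 addn2.
Qed.

End radial.

(** * One cell *)

Section cell.
Context {R : realType} {d : nat}.
Implicit Types (x y z : 'rV[R]_d) (P : set 'rV[R]_d).
Local Open Scope ereal_scope.

(** Written as a scaling followed by a translation, so that [lebesgue_rV_affine] applies with
    [k = 2^-1]. *)
Definition mid z x : 'rV[R]_d := ((2^-1 : R) *: x + (2^-1 : R) *: z)%R.

Lemma convex_comb_mid P x z : convex_comb P -> P z -> P x -> P (mid z x).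
Proof.
move=> cP Pz Px; have := @cP x z 2^-1%R Px Pz.
rewrite (_ : 1 - 2^-1 = 2^-1 :> R)%R; last lra.
by apply; lra.
Qed.

(** [mid z] maps [P] into [P]. With [F] extended by zero outside [P], the integrals run over the
    whole space, where the image of Lebesgue measure under [mid z] is [2^d] times Lebesgue
    measure. *)
Lemma integral_mid_le P z (F : 'rV[R]_d -> \bar R) :
  measurable P -> convex_comb P -> P z -> measurable_fun P F ->
  (forall x, 0 <= F x) ->
  \int[@lebesgue_rV R d]_(x in P) F (mid z x) <=
  (2 ^+ d)%:E * \int[@lebesgue_rV R d]_(x in P) F x.
Proof.
move=> mP cP Pz mF F0.
have mG : measurable_fun setT (F \_ P) by exact: (iffLR (measurable_restrictT _ mP)).
have G0 x : 0 <= (F \_ P) x by rewrite patchE; case: ifP.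
have mmid : measurable_fun setT (mid z) by exact: measurable_fun_affine.
have d2 : (0 <= 2 ^+ d :> R)%R by rewrite exprn_ge0.
rewrite [X in _ <= _ * X]integral_mkcond.
rewrite -[leRHS](@ge0_integral_mscale _ _ _ (@lebesgue_rV R d) _ measurableT (NngNum d2))//.
rewrite [leRHS](_ : _ = \int[pushforward (@lebesgue_rV R d) (mid z)]_x (F \_ P) x); last first.
  apply: eq_measure_integral => A mA _ /=.
  rewrite /pushforward /mscale /= [X in _ * X = _](@lebesgue_rV_affine _ _ 2^-1%R (2^-1 *: z)%R)//.
  by rewrite muleA -EFinM -exprMn divff// expr1n mul1e.
rewrite ge0_integral_pushforward// preimage_setT.
rewrite [leLHS]integral_mkcond; apply: ge0_le_integral => //.
- by move=> x _; rewrite patchE; case: ifP.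
- rewrite (_ : _ \_ _ = ((F \_ P) \o mid z) \_ P).
    apply: (iffLR (measurable_restrictT _ mP)); apply: measurable_funTS.
    exact: measurableT_comp.
  apply/funext => x; rewrite patchE [RHS]patchE; case: ifPn => //= /set_mem Px.
  by rewrite patchE mem_set//; exact: convex_comb_mid.
- exact: measurableT_comp.
- move=> x _; rewrite patchE; case: ifPn => [/set_mem Px|_]; last exact: G0.
  by rewrite /= patchE mem_set//; exact: convex_comb_mid.
Qed.

(** The pointwise bound is integrated over [P], and [integral_mid_le] absorbs the midpoint term. The
    error [q] will be zero when [phi] is unbounded below; otherwise it collects the defect of
    near-minimality and the radial tail. *)
Lemma integral_midpoint_ge P z (phi q : 'rV[R]_d -> R) (c : R) :
  measurable P -> convex_comb P -> P z -> measurable_fun P phi ->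
  measurable_fun P q -> (forall x, 0 <= q x)%R -> (0 <= c)%R ->
  (forall x, P x -> c <= `|phi x| + `|phi (mid z x)| + q x)%R ->
  c%:E * lebesgue_rV P <=
  (1 + 2 ^+ d)%:E * \int[@lebesgue_rV R d]_(x in P) `|phi x|%:E +
  \int[@lebesgue_rV R d]_(x in P) (q x)%:E.
Proof.
move=> mP cP Pz mphi mq q0 c0 cle.
have mphi' : measurable_fun P (fun x => `|phi x|%:E).
  by apply/measurable_EFinP; exact: measurableT_comp.
have mmid : measurable_fun P (fun x => `|phi (mid z x)|%:E).
  apply/measurable_EFinP; apply: measurableT_comp => //.
  apply: (measurable_comp mP _ mphi); last by apply: measurable_funTS; exact: measurable_fun_affine.
  by move=> _ [x Px <-]; exact: convex_comb_mid.
have I0 : 0 <= \int[@lebesgue_rV R d]_(x in P) `|phi x|%:E.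
  by apply: integral_ge0 => x _; rewrite lee_fin.
apply: (@le_trans _ _ (\int[@lebesgue_rV R d]_(x in P)
    (`|phi x|%:E + `|phi (mid z x)|%:E + (q x)%:E))).
  rewrite -integral_cst//; apply: ge0_le_integral => //.
  apply: emeasurable_funD; last exact/measurable_EFinP.
  exact: emeasurable_funD.
rewrite ge0_integralD//; last 4 first.
- by move=> x _; rewrite -EFinD lee_fin addr_ge0.
- exact: emeasurable_funD.
- by move=> x _; rewrite lee_fin.
- exact/measurable_EFinP.
rewrite leeD2r// ge0_integralD// EFinD ge0_muleDl ?lee_fin ?exprn_ge0//.
rewrite mul1e leeD2l//; exact: (@integral_mid_le P z (fun x => `|phi x|%:E)).
Qed.

End cell.

Section cell_bound.
Context {R : realType} {d : nat}.
Local Open Scope ereal_scope.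

(** Strong convexity enters through its midpoint form. If [phi] is bounded below on [P], then [z]
    nearly attains the infimum; otherwise [phi z] is taken very negative. *)
Lemma strongly_convex_cell_ge (P : set 'rV[R]_d) (phi : 'rV[R]_d -> R) (k r w : R) :
  measurable P -> convex_comb P -> lebesgue_rV P < +oo ->
  measurable_fun P phi -> (0 < k)%R -> (0 <= r)%R ->
  lebesgue_rV [set x : 'rV[R]_d | (enorm x < 1)%R] = w%:E ->
  (forall x z, P x -> P z ->
    phi (mid z x) <= (phi x + phi z) / 2 - k / 8 * dot (x - z) (x - z))%R ->
  (k / 4 * r ^+ 2)%:E * lebesgue_rV P <=
  (1 + 2 ^+ d)%:E * \int[@lebesgue_rV R d]_(x in P) `|phi x|%:E +
  (k / 4 * (2 * w * r ^+ (d + 2) / (d%:R + 2)))%:E.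
Proof.
move=> mP cP Poo mphi k0 r0 hw sc.
have w0 : (0 <= w)%R by rewrite -lee_fin -hw measure_ge0.
have I0 : 0 <= \int[@lebesgue_rV R d]_(x in P) `|phi x|%:E.
  by apply: integral_ge0 => x _; rewrite lee_fin.
have T0 : (0 <= k / 4 * (2 * w * r ^+ (d + 2) / (d%:R + 2)))%R.
  by rewrite !(mulr_ge0, divr_ge0, exprn_ge0, addr_ge0)// ltW.
have rhs0 : 0 <= (1 + 2 ^+ d)%:E * \int[@lebesgue_rV R d]_(x in P) `|phi x|%:E.
  by rewrite mule_ge0// lee_fin addr_ge0// exprn_ge0.
have kr0 : (0 <= k / 4 * r ^+ 2)%R by rewrite mulr_ge0 ?exprn_ge0// divr_ge0// ltW.
have [->|/set0P[x0 Px0]] := eqVneq P set0.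
  by rewrite measure0 mule0 adde_ge0// integral_set0 mule0.
pose E := [set phi x | x in P].
have [lbE|nlb] := pselect (has_lbound E); last first.
  (* A point [z] where [phi] is very negative forces [|phi|] to be large at [x]
     or at the midpoint of [x] and [z]. *)
  have [z [Pz hz]] : exists z, P z /\ (phi z < - (k / 2 * r ^+ 2))%R.
    apply: contrapT => h; apply: nlb; exists (- (k / 2 * r ^+ 2))%R => _ [z Pz <-].
    by rewrite leNgt; apply/negP => hz; apply: h; exists z.
  have := @integral_midpoint_ge _ _ P z phi (fun=> 0%R) _ mP cP Pz mphi _ _ kr0 _.
  rewrite integral0 adde0 => h; apply: le_trans (h _ _ _) _ => //.
    move=> x Px {h}; have := sc _ _ Px Pz; have := normr_ge0 (phi x).
    have := ler_norm (phi x); have := ler_norm (- phi (mid z x)); rewrite normrN.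
    have : (0 <= k * dot (x - z) (x - z))%R by rewrite mulr_ge0 ?dot_ge0 ?ltW.
    lra.
  by rewrite leeDl// lee_fin.
have infE : has_inf E by split => //; exists (phi x0), x0.
pose V := fine (lebesgue_rV P).
have VE : lebesgue_rV P = V%:E by rewrite fineK// ge0_fin_numE// measure_ge0.
have V0 : (0 <= V)%R by rewrite fine_ge0// measure_ge0.
(* Near-minimality costs [e'] at each point of [P], in total [e' V <= e]; the denominator [V + 1]
   covers [V = 0]. *)
apply/lee_addgt0Pr => e e0; pose e' := (e / (V + 1))%R.
have e'0 : (0 < e')%R by rewrite divr_gt0// ltr_wpDl.
have [_ [z Pz <-] hz] := inf_adherent e'0 infE.
pose q x := (e' + k / 4 * Num.max 0 (r ^+ 2 - dot (x - z) (x - z)))%R.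
have m0 x : (0 <= Num.max 0 (r ^+ 2 - dot (x - z) (x - z)))%R by rewrite le_max lexx.
have mm : measurable_fun setT (fun x : 'rV[R]_d => Num.max 0 (r ^+ 2 - dot (x - z) (x - z)))%R.
  apply: measurable_maxr => //.
  by apply: measurable_funB => //; exact: measurable_fun_sqdist.
have mq : measurable_fun setT q.
  by apply: measurable_funD => //; apply: measurable_funM.
have q0 x : (0 <= q x)%R by rewrite addr_ge0 ?(ltW e'0)// mulr_ge0// divr_ge0// ltW.
apply: (@le_trans _ _ ((1 + 2 ^+ d)%:E * \int[@lebesgue_rV R d]_(x in P) `|phi x|%:E +
    \int[@lebesgue_rV R d]_(x in P) (q x)%:E)).
  apply: (@integral_midpoint_ge _ _ P z) => //; first exact: measurable_funTS.
  (* Since [phi z < phi (mid z x) + e'], the midpoint inequality gives [k/4 |x - z|^2 <= phi x - phi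
     (mid z x) + e']; the positive part in [q] raises [|x - z|^2] to at least [r^2]. *)
  move=> x Px; have Pm := convex_comb_mid cP Pz Px.
  have := ge_inf lbE (imageP phi Pm); have := sc _ _ Px Pz.
  have := ler_norm (phi x); have := ler_norm (- phi (mid z x)); rewrite normrN.
  rewrite /q; set D := dot _ _.
  have : (k / 4 * (r ^+ 2 - D) <= k / 4 * Num.max 0 (r ^+ 2 - D))%R.
    by rewrite ler_wpM2l ?le_max ?lexx ?orbT// divr_ge0// ltW.
  set M := (k / 4 * Num.max _ _)%R; set a := `|phi x|%R; set b := `|phi _|%R.
  move: hz; set m := inf _; set p := phi (mid z x).
  set kr := (r ^+ 2)%R.
  lra.
rewrite -addeA leeD2l//.
under eq_integral do rewrite /q EFinD.
rewrite ge0_integralD//; last 3 first.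
- by move=> x _; rewrite lee_fin ltW.
- by move=> x _; rewrite lee_fin mulr_ge0// divr_ge0// ltW.
- by apply/measurable_EFinP; apply: measurable_funM => //; exact: measurable_funTS.
under [X in _ + X <= _]eq_integral do rewrite EFinM.
rewrite ge0_integralZl_EFin//; last 3 first.
- by move=> x _; rewrite lee_fin.
- by apply/measurable_EFinP; exact: measurable_funTS.
- by rewrite divr_ge0// ltW.
rewrite addeC (EFinM (k / 4)) leeD//.
  rewrite lee_pmul2l ?fin_numE// ?lte_fin ?divr_gt0//.
  (* The tail is nonnegative, so its integral over [P] is at most that over the whole space,
     whatever the shape of [P]. *)
  apply: le_trans (integral_radial_tail z r0 hw).
  apply: ge0_subset_integral => //; last by move=> x _; rewrite lee_fin.
  exact/measurable_EFinP.
rewrite integral_cst// [X in _ * X]VE -EFinM lee_fin.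
by rewrite /e' mulrAC ler_pdivrMr ?ltr_wpDl// ler_pM2l// lerDl.
Qed.

End cell_bound.

(** * The partition into cells *)

Section cells.
Context {R : realType} {d N : nat}.
Variables (a : 'I_N.+1 -> 'rV[R]_d) (b : 'I_N.+1 -> R).

Let l j x := dot (a j) x + b j.

(* The points where [j] is the first index attaining the maximum; breaking ties
   this way makes the cells a partition. *)
Definition max_cell (j : 'I_N.+1) : set 'rV[R]_d := [set x | forall i : 'I_N.+1,
  if (i < j)%N then l i x < l j x else l i x <= l j x].

Lemma max_cell_le j x : max_cell j x -> forall i, l i x <= l j x.
Proof. by move=> h i; have := h i; case: ifP => // _ /ltW. Qed.

Lemma max_affine_cell j x : max_cell j x -> max_affine a b x = l j x.
Proof.
move=> /max_cell_le h; apply/le_anti/andP; split.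
  by apply: bigmax_le => [|i _]; exact: h.
exact: (le_bigmax _ (fun i => l i x)).
Qed.

Lemma trivIset_max_cell (D : set 'I_N.+1) : trivIset D max_cell.
Proof.
apply/trivIsetP => i j _ _ ij; apply/seteqP; split => // x [hi hj].
case: (ltngtP i j) => [ltij|ltji|/val_inj eij]; last by rewrite eij eqxx in ij.
  by have := hj i; rewrite ltij ltNge (max_cell_le hi).
by have := hi j; rewrite ltji ltNge (max_cell_le hj).
Qed.

(** The least index attaining the maximum at [x] is chosen; a smaller index with at least the same
    value would attain it too. *)
Lemma bigcup_max_cell : \bigcup_j max_cell j = setT.
Proof.
apply/seteqP; split => // x _.
have [i0 _ hi0] := Order.TotalTheory.arg_maxP (fun i => l i x) (isT : xpredT (ord0 : 'I_N.+1)).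
have Pi0 : [forall i, l i x <= l i0 x] by apply/forallP => i; exact: hi0.
have [j /forallP hj jmin] := arg_minnP (P := fun j => [forall i, l i x <= l j x]) val Pi0.
exists j => // i; case: ifP => ij; last exact: hj.
rewrite ltNge; apply/negP => hji.
have /jmin : [forall k, l k x <= l i x].
  by apply/forallP => k; exact: le_trans (hj k) hji.
by rewrite leqNgt ij.
Qed.

Lemma measurable_max_cell j : measurable (max_cell j).
Proof.
have ml i : measurable_fun setT (l i).
  by apply: measurable_funD => //; exact: measurable_fun_dot.
rewrite (_ : max_cell j = \bigcap_(i in [set: 'I_N.+1])
  [set x | if (i < j)%N then l i x < l j x else l i x <= l j x]); last first.
  by apply/seteqP; split => x /= h i *; exact: h.
apply: fin_bigcap_measurable => // i _; case: (i < j)%N.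
  have /(_ measurableT [set true]) := measurable_fun_ltr (ml i) (ml j).
  by rewrite setTI; exact.
have /(_ measurableT [set true]) := measurable_fun_ler (ml i) (ml j).
by rewrite setTI; exact.
Qed.

(** A cell is an intersection of open and closed half-spaces, possibly degenerate. *)
Lemma convex_max_cell j : convex_comb (max_cell j).
Proof.
move=> x y t hx hy /andP[t0 t1] i; have := hx i; have := hy i.
have le : l i x <= l j x -> l i y <= l j y ->
    l i (t *: x + (1 - t) *: y) <= l j (t *: x + (1 - t) *: y).
  rewrite /l !dot_combr => hx' hy'.
  have : 0 <= t * (dot (a j) x + b j - (dot (a i) x + b i)) by rewrite mulr_ge0// subr_ge0.
  have : 0 <= (1 - t) * (dot (a j) y + b j - (dot (a i) y + b i)) by rewrite mulr_ge0// subr_ge0.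
  lra.
case: ifP => _ hyi hxi; last exact: le.
rewrite /l !dot_combr; have [->|t1'] := eqVneq t 1.
  by move: hxi; rewrite subrr !mul0r !addr0 !mul1r.
have : 0 <= t * (dot (a j) x + b j - (dot (a i) x + b i)) by rewrite mulr_ge0// subr_ge0 ltW.
have : 0 < (1 - t) * (dot (a j) y + b j - (dot (a i) y + b i)).
  by rewrite mulr_gt0// subr_gt0// lt_neqAle t1'.
lra.
Qed.

Lemma ge0_integral_max_cells (mu : {measure set 'rV[R]_d -> \bar R})
    (Omega : set 'rV[R]_d) (F : 'rV[R]_d -> \bar R) :
  measurable Omega -> measurable_fun Omega F -> (forall x, 0 <= F x)%E ->
  (\int[mu]_(x in Omega) F x =
   \sum_(j < N.+1) \int[mu]_(x in Omega `&` max_cell j) F x)%E.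
Proof.
move=> mO mF F0.
have OE : Omega = \big[setU/set0]_(j <- index_enum 'I_N.+1) (Omega `&` max_cell j).
  rewrite -bigcup_seq (_ : [set` _] = setT); last first.
    by apply/seteqP; split => // i _ /=; rewrite mem_index_enum.
  by rewrite -setI_bigcupr bigcup_max_cell setIT.
rewrite {1}OE ge0_integral_bigsetU//.
- by move=> j; apply: measurableI => //; exact: measurable_max_cell.
- exact: index_enum_uniq.
- exact/trivIset_setIl/trivIset_max_cell.
- by rewrite -OE.
Qed.

End cells.

(** * Comparison of [mu] with Lebesgue measure *)

Section density.
Context {R : realType} {d : nat}.
Local Open Scope ereal_scope.

(** The bound on [rho] holds almost everywhere, so [rho] is replaced by its maximum with [lambda],
    which agrees with it almost everywhere on [Omega] and is at least [lambda] at every point. *)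
Lemma density_on_ge (mu : probability 'rV[R]_d R) (Omega : set 'rV[R]_d)
    (rho : 'rV[R]_d -> R) (lambda : R) (A : set 'rV[R]_d) :
  measurable Omega -> density_on mu Omega rho -> (0 < lambda)%R ->
  {ae @lebesgue_rV R d, forall x, Omega x -> (lambda <= rho x)%R} ->
  measurable A -> lambda%:E * lebesgue_rV (A `&` Omega) <= mu A.
Proof.
move=> mO [mrho _ muE] l0 hrho mA; rewrite muE//.
have mAO : measurable (A `&` Omega) by exact: measurableI.
have mr : measurable_fun (A `&` Omega) rho.
  by apply: measurable_funS mrho => // x [].
have mm : measurable_fun (A `&` Omega) (fun x => Num.max lambda (rho x)).
  exact: measurable_maxr.
rewrite (@ae_eq_integral _ _ _ _ _ (fun x => (Num.max lambda (rho x))%:E))//.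
- rewrite -integral_cst//; apply: ge0_le_integral => //.
  + by move=> x _; rewrite lee_fin ltW.
  + exact/measurable_EFinP.
  + by move=> x _; rewrite lee_fin le_max lexx.
- exact/measurable_EFinP.
- exact/measurable_EFinP.
apply: filterS hrho => x hx [_ /hx lr]; by rewrite max_r.
Qed.

(** By [density_on_ge], [mu] dominates [lambda] times Lebesgue measure restricted to [Omega]; this
    passes to integrals of nonnegative functions. *)
Lemma L1norm_ge (mu : probability 'rV[R]_d R) (Omega : set 'rV[R]_d)
    (rho h : 'rV[R]_d -> R) (lambda : R) :
  measurable Omega -> density_on mu Omega rho -> (0 < lambda)%R ->
  {ae @lebesgue_rV R d, forall x, Omega x -> (lambda <= rho x)%R} ->
  measurable_fun Omega h ->
  lambda%:E * \int[@lebesgue_rV R d]_(x in Omega) `|h x|%:E <= L1norm mu Omega h.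
Proof.
move=> mO hmu l0 hrho mh; rewrite /L1norm Lnorm1.
pose G x := `|((EFin \o h) \_ Omega) x|.
have G0 x : 0 <= G x by exact: abse_ge0.
have mG : measurable_fun setT G.
  apply: measurableT_comp => //; apply: (iffLR (measurable_restrictT _ mO)).
  exact/measurable_EFinP.
pose m1 : {measure set 'rV[R]_d -> \bar R} :=
  mscale (NngNum (ltW l0)) (mrestr (@lebesgue_rV R d) mO).
have m1le S : measurable S -> m1 S <= mu S.
  by move=> mS; exact: (density_on_ge mO hmu l0 hrho mS).
apply: (@le_trans _ _ (\int[mu]_(x in Omega) G x)); last first.
  exact: ge0_subset_integral.
apply: le_trans (ge0_le_measure_integral m1le mO G0 mG).
rewrite (@eq_measure_integral _ _ _ _ (mscale (NngNum (ltW l0)) (@lebesgue_rV R d))); last first.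
  by move=> A mA AO; rewrite /m1 /= /mscale /= /mrestr setIidl.
rewrite ge0_integral_mscale//; last exact: measurable_funTS.
rewrite le_eqVlt; apply/orP; left; apply/eqP; congr (_ * _).
by apply: eq_integral => x xO; rewrite /G patchE xO.
Qed.

End density.

(** * The radius, and the sum over the cells *)

Lemma optimal_radius (R : realType) (d n : nat) (V w : R) :
  (0 < d)%N -> (0 < n)%N -> 0 < V -> 0 < w ->
  exists r : R, [/\ 0 <= r, n%:R * w * r ^+ d = V &
    r ^+ 2 = V `^ (2 / d%:R) * w `^ (- (2 / d%:R)) * n%:R `^ (- (2 / d%:R))].
Proof.
move=> d0 n0 V0 w0; have n0' : 0 < n%:R :> R by rewrite ltr0n.
have dn0 : d%:R != 0 :> R by rewrite pnatr_eq0 -lt0n.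
have nw0 : 0 < n%:R * w by rewrite mulr_gt0.
(* With this radius [n] balls have total volume [V]; it maximises
   [V r^2 - 2 n w r^(d+2) / (d+2)]. *)
exists ((V / (n%:R * w)) `^ d%:R^-1); split; first exact: powR_ge0.
  rewrite -powR_mulrn ?powR_ge0// -powRrM mulVf// powRr1 ?divr_ge0 ?ltW//.
  by rewrite mulrC divfK// gt_eqF.
have invE (x s : R) : 0 < x -> x^-1 `^ s = x `^ (- s).
  by move=> x0; rewrite -powR_inv1 ?ltW// -powRrM mulN1r.
rewrite -powR_mulrn ?powR_ge0// -powRrM (mulrC _ 2%:R).
rewrite powRM ?invr_ge0 ?ltW// invE// powRM ?ltW//.
by rewrite [X in _ * X]mulrC mulrA.
Qed.

Lemma measurable_max_affine (R : realType) (d N : nat)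
    (a : 'I_N.+1 -> 'rV[R]_d) (b : 'I_N.+1 -> R) :
  measurable_fun setT (max_affine a b).
Proof.
have ml j : measurable_fun setT (fun x => dot (a j) x + b j).
  by apply: measurable_funD => //; exact: measurable_fun_dot.
rewrite /max_affine; elim: (index_enum _) => [|i s IH].
  by under eq_fun do rewrite big_nil; exact: ml.
by under eq_fun do rewrite big_cons; exact: measurable_maxr.
Qed.

Section lower_bound.
Context {R : realType} {d N : nat}.
Local Open Scope ereal_scope.

(** [strongly_convex_cell_ge] is summed over the cells with one common [r]; its tail term does not
    depend on the cell, so it appears [N.+1] times. *)
Lemma integral_max_affine_ge (Omega : set 'rV[R]_d) (f : 'rV[R]_d -> R)
    (k c r w : R) (a : 'I_N.+1 -> 'rV[R]_d) (b : 'I_N.+1 -> R) :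
  open Omega -> convex_set Omega -> lebesgue_rV Omega < +oo ->
  (0 < k)%R -> strongly_convex k Omega f -> (0 <= r)%R ->
  lebesgue_rV [set x : 'rV[R]_d | (enorm x < 1)%R] = w%:E ->
  (k / 4 * r ^+ 2)%:E * lebesgue_rV Omega <=
  (1 + 2 ^+ d)%:E *
    \int[@lebesgue_rV R d]_(x in Omega) `|max_affine a b x - f x - c|%:E +
  (N.+1%:R * (k / 4 * (2 * w * r ^+ (d + 2) / (d%:R + 2))))%:E.
Proof.
move=> oO cO Ooo k0 scf r0 hw.
have mO := open_measurable_rV oO.
have mf : measurable_fun Omega f by exact: strongly_convex_measurable scf.
set C := (k / 4 * (_ / _))%R.
have kr0 : (0 <= k / 4 * r ^+ 2)%R by rewrite mulr_ge0 ?exprn_ge0// divr_ge0// ltW.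
pose P j := Omega `&` max_cell a b j.
have mP j : measurable (P j) by apply: measurableI => //; exact: measurable_max_cell.
have ml j : measurable_fun setT (fun x => dot (a j) x + b j)%R.
  by apply: measurable_funD => //; exact: measurable_fun_dot.
have mh : measurable_fun Omega (fun x => `|max_affine a b x - f x - c|%:E).
  apply/measurable_EFinP; apply: measurableT_comp => //.
  apply: measurable_funB => //; apply: measurable_funB => //.
  apply: measurable_funTS; exact: measurable_max_affine.
rewrite -integral_cst//.
rewrite (ge0_integral_max_cells a b)//.
rewrite (@ge0_integral_max_cells _ _ _ a b _ _ (fun x => `|max_affine a b x - f x - c|%:E))//.
rewrite ge0_sume_distrr; last by move=> j _; exact: integral_ge0.
rewrite (_ : (N.+1%:R * C)%:E = \sum_(j < N.+1) C%:E); last first.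
  by rewrite sumEFin sumr_const card_ord mulr_natl.
rewrite -big_split /=; apply: lee_sum => j _.
rewrite integral_cst; last exact: mP.
(* On its cell the maximum is one affine piece; the sign is reversed so that [f] enters with a plus
   and the function is strongly convex. *)
have -> : \int[@lebesgue_rV R d]_(x in P j) `|max_affine a b x - f x - c|%:E =
    \int[@lebesgue_rV R d]_(x in P j) `|f x + c - (dot (a j) x + b j)|%:E.
  apply: eq_integral => x /set_mem[_ xj]; rewrite (max_affine_cell xj).
  by rewrite -normrN; congr (`| _ |%:E); ring.
apply: (@strongly_convex_cell_ge _ _ (P j) (fun x => f x + c - (dot (a j) x + b j))%R) => //.
- move=> x y t [Ox xj] [Oy yj] t01; split; first exact: convex_set_comb.
  exact: convex_max_cell.
- by apply: le_lt_trans Ooo; apply: le_measure; rewrite ?inE// => x [].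
- apply: (@measurable_funB _ _ R (P j) (fun x => f x + c)%R
    (fun x => dot (a j) x + b j)%R); last exact: measurable_funTS.
  by apply: measurable_funD => //; apply: (measurable_funS mO _ mf) => x [].
(* At weight [1/2] the gain is [k/8 |x - z|^2]; the affine piece does not change it. *)
- move=> x z [Ox _] [Oz _].
  have h01 : (0 <= (2^-1 : R) <= 1)%R by lra.
  have := strongly_convexP scf Ox Oz h01.
  rewrite (_ : 1 - 2^-1 = 2^-1 :> R)%R; last lra.
  rewrite -[X in f X]/(mid z x) /mid dot_combr.
  set D := dot (x - z) _; set p := f _.
  lra.
Qed.

End lower_bound.

(** * The lower bound for every shift [c], with the explicit constant *)

Theorem proposition2p7 (R : realType) (d : nat) (hd : (0 < d)%N)
  (Omega : set 'rV[R]_d) (hopen : open Omega) (hconv : convex_set Omega)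
  (alpha : R) (halpha : 0 < alpha < 1)
  (hbd : Ckalpha_boundary 2 alpha Omega)
  (mu : probability 'rV[R]_d R) (rho : 'rV[R]_d -> R)
  (hmu : density_on mu Omega rho)
  (lambda : R) (hlambda : 0 < lambda)
  (hrho : {ae @lebesgue_rV R d, forall x, Omega x -> lambda <= rho x})
  (kappa : R) (hkappa : 0 < kappa)
  (f : 'rV[R]_d -> R) (hf : strongly_convex kappa Omega f)
  (n : nat) (hn : (1 <= n)%N) (N : nat) (hN : (N.+1 <= n)%N)
  (a : 'I_N.+1 -> 'rV[R]_d) (b : 'I_N.+1 -> R) :
  ((lambda * c_ R d * kappa)%:E
     * lebesgue_rV Omega `^ (1 + 2 / d%:R)%R
     * (n%:R `^ (- (2 / d%:R)))%:E
   <= ereal_inf [set L1norm mu Omega (fun x => max_affine a b x - f x - c)%R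
                | c in [set: R]])%E.
Proof.
have mO := open_measurable_rV hopen.
have n0' : 0 < n%:R :> R by rewrite ltr0n.
have dn0 : d%:R != 0 :> R by rewrite pnatr_eq0 -lt0n.
(* The volume is finite because [lambda |Omega|] is at most the total mass 1 of [mu]. *)
have Ooo : (lebesgue_rV Omega < +oo)%E.
  have := density_on_ge mO hmu hlambda hrho measurableT.
  rewrite setTI probability_setT ltey; apply: contraTneq => ->.
  by rewrite gt0_muley ?lte_fin// leye_eq.
have VE : lebesgue_rV Omega = (fine (lebesgue_rV Omega))%:E.
  by rewrite fineK// ge0_fin_numE// measure_ge0.
set V := fine _ in VE; have V0 : 0 <= V by rewrite fine_ge0// measure_ge0.
apply/ereal_infP => _ [c _ <-].
set h := fun x => max_affine a b x - f x - c.
have L0 : (0 <= L1norm mu Omega h)%E by exact: Lnorm_ge0.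
rewrite VE poweR_EFin -!EFinM.
pose w := unit_ball_volume R d.
have w0 : 0 <= w by rewrite fine_ge0// measure_ge0.
(* [w = 0] also covers a ball of infinite measure ([fine +oo = 0]); then [c_] is
   [0], because [0 `^ s = 0] for [s != 0]. *)
have [w_eq0|w_neq0] := eqVneq w 0.
  rewrite /c_ -/w w_eq0 powR0; last by rewrite oppr_eq0 mulf_neq0 ?invr_eq0// pnatr_eq0.
  by rewrite mulr0 !mul0r mulr0 !mul0r.
(* [fine] sends infinite values to 0, so a nonzero [w] is the true volume of the ball. *)
have hw : lebesgue_rV [set x : 'rV[R]_d | enorm x < 1] = w%:E.
  move: w_neq0; rewrite /w /unit_ball_volume.
  have := measure_ge0 (@lebesgue_rV R d) [set x : 'rV[R]_d | enorm x < 1].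
  by case: (lebesgue_rV _) => //= _; rewrite eqxx.
have w_gt0 : 0 < w by rewrite lt_neqAle eq_sym w_neq0.
have d20 : 0 <= 2 / d%:R :> R by rewrite divr_ge0.
(* For [V = 0] the left-hand side vanishes, the exponent [1 + 2 / d] being nonzero. *)
have [V_eq0|V_neq0] := eqVneq V 0.
  by rewrite V_eq0 powR0 ?mulr0 ?mul0r// gt_eqF// ltr_pwDl.
have V_gt0 : 0 < V by rewrite lt_neqAle eq_sym V_neq0.
have [r [r0 rd r2]] := @optimal_radius R d n V w hd hn V_gt0 w_gt0.
have key := integral_max_affine_ge c a b hopen hconv Ooo hkappa hf r0 hw.
have mh : measurable_fun Omega h.
  apply: measurable_funB => //; apply: measurable_funB => //.
    by apply: measurable_funTS; exact: measurable_max_affine.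
  exact: strongly_convex_measurable hf.
apply: le_trans (L1norm_ge mO hmu hlambda hrho mh).
rewrite -/h in key.
have : (0 <= \int[@lebesgue_rV R d]_(x in Omega) `|h x|%:E)%E.
  by apply: integral_ge0 => x _; rewrite lee_fin.
(* An infinite integral makes the bound trivial; otherwise the inequality is one between reals. *)
move: key; rewrite VE; case: (integral _ _ _) => [i| |] // key i0; last first.
  by rewrite gt0_muley ?lte_fin// leey.
move: key; rewrite -!EFinM -EFinD !lee_fin => key.
rewrite -!mulrA ler_pM2l// powRD; last by rewrite V_neq0 implybT.
rewrite powRr1//.
have dp : 0 < d%:R + 2 :> R by rewrite ltr_wpDl.
have d2p : 0 < 1 + 2 ^+ d :> R by rewrite ltr_wpDr// exprn_ge0.
(* By [r2] the powers of [V], [w] and [n] combine to [V r^2]. *)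
rewrite [leLHS](_ : _ = d%:R * kappa * V * r ^+ 2 / (4 * ((d%:R + 2) * (1 + 2 ^+ d)))); last first.
  by rewrite r2 -/w; ring.
rewrite ler_pdivrMr ?mulr_gt0//.
(* There are at most [n] tails, and [n w r^d = V] turns their sum into a multiple of [V r^2]. *)
have nC : N.+1%:R * (kappa / 4 * (2 * w * r ^+ (d + 2) / (d%:R + 2))) <=
    kappa / 4 * (2 * V * r ^+ 2) / (d%:R + 2).
  rewrite [leRHS](_ : _ = n%:R * (kappa / 4 * (2 * w * r ^+ (d + 2) / (d%:R + 2)))).
    rewrite ler_wpM2r ?ler_nat// !(mulr_ge0, divr_ge0, exprn_ge0)//; exact: ltW.
  by rewrite -rd exprD; ring.
have := le_trans key (lerD (lexx _) nC).
rewrite -(ler_pM2r dp) [in X in _ <= X -> _]mulrDl divfK ?gt_eqF// => k1.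
(* Subtracting the tails leaves the factor [1 - 2 / (d + 2) = d / (d + 2)], whence the numerator [d]
   in [c_]. *)
lra.
Qed.
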